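(* The relation $[\omega,\omega,2,3]\to 3$ fails; that is, there exist a $2$-almost disjoint family $\mathcal A\subseteq[\omega]^{\omega}$ and a partial function $f$ from $\omega$ to $3=\{0,1,2\}$ with $|A\cap\operatorname{dom}(f)|\le 3$ for every $A\in\mathcal A$, such that there is no function $g:\omega\to 3$ with $g\supseteq f$ which is a conflict free coloring of $\mathcal A$.
   Context: A family is $2$-almost disjoint if any two distinct members have at most one common element. $g:\omega\to 3$ is a conflict free coloring of $\mathcal A$ if for every $A\in\mathcal A$ there is $i<3$ with $|A\cap g^{-1}\{i\}|=1$. In general, $[\lambda,\kappa,d,k]\to x$ denotes: for every $d$-almost disjoint $\mathcal A\subseteq[\lambda]^\kappa$ and every partial function $f$ from $\lambda$ to $x$ with $|A\cap\operatorname{dom}(f)|\le k$ for all $A\in\mathcal A$, there is a conflict free coloring $g:\lambda\to x$ of $\mathcal A$ with $g\supseteq f$. *)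

(* Defs.v *)
From Stdlib Require Import List Arith.
Import ListNotations.

Definition infinite_set (A : nat -> Prop) : Prop :=
  forall n, exists m, n <= m /\ A m.

Definition card_le (S : nat -> Prop) (k : nat) : Prop :=
  exists l : list nat, length l <= k /\ forall x, S x -> In x l.

Definition exactly_one (S : nat -> Prop) : Prop :=
  exists x, S x /\ forall y, S y -> y = x.

Definition almost_disjoint (d : nat) (F : (nat -> Prop) -> Prop) : Prop :=
  forall A B, F A -> F B -> A <> B ->
    card_le (fun x => A x /\ B x) (d - 1).

(* Colours are the numbers 0,1,2 = 3. A partial function omega -> 3 is
   f : nat -> option nat with values < 3; dom f = {x | f x <> None}. *)
Definition partial_into (c : nat) (f : nat -> option nat) : Prop :=
  forall x i, f x = Some i -> i < c.

Definition conflict_free (c : nat) (F : (nat -> Prop) -> Prop) (g : nat -> nat) : Prop :=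
  forall A, F A -> exists i, i < c /\ exactly_one (fun x => A x /\ g x = i).

Definition extends (g : nat -> nat) (f : nat -> option nat) : Prop :=
  forall x i, f x = Some i -> g x = i.

(* Main.v *)
(** A line with three private precoloured points, of colours [v, v, u], that
    contains a further point of colour [u] must contain exactly one point of the
    third colour.

    Let [a, b, c] be the three colours and suppose two points [x], [x'] both
    have colour [a].  A line through [x] precoloured [b, b, a] (the axis) has
    exactly one point [z] of colour [c].  Each point [z] of the axis comes with
    a grid whose rows are lines [b, b, a] through [x], whose columns are lines
    [c, c, a] through [x'], and whose antidiagonals are lines [b, b, c] through
    [z].  If [z] has colour [c], every row has at most one [c], every column at
    most one [b] and every antidiagonal at most one [a]; a 4 by 4 subgrid, which
    meets 4 rows, 4 columns and 7 antidiagonals, would then have at most 15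
    points.  So two points to which such a gadget is attached for each colour
    have different colours; this is impossible for all pairs of 4 points. *)

Require Import Defs.
From Stdlib Require Import List Arith Lia Classical Cantor.
Import ListNotations.

(* [(i, j, a)] is the gadget refuting colour [a mod 3] for both of the roots [i]
   and [i + S j]. *)
Definition gadget : Type := nat * nat * nat.

(* [Row q n _], [Column q n _], [Antidiagonal q n _] are the lines of the grid
   belonging to the axis point [Own (Axis q) (3 + n)]. *)
Inductive line : Type :=
| Axis (q : gadget)
| Row (q : gadget) (n r : nat)
| Column (q : gadget) (n s : nat)
| Antidiagonal (q : gadget) (n d : nat).

(* [Own l 0], [Own l 1], [Own l 2] are the precoloured points of [l]; the grid
   point in row [r] and column [s] is [Own (Row q n r) (3 + s)]. *)
Inductive point : Type :=
| Root (i : nat)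
| Own (l : line) (m : nat).

Inductive on : point -> line -> Prop :=
| on_own l m : on (Own l m) l
| root_on_axis i j a : on (Root i) (Axis (i, j, a))
| root_on_row i j a n r : on (Root i) (Row (i, j, a) n r)
| root_on_column i j a n s : on (Root (i + S j)) (Column (i, j, a) n s)
| grid_on_column q n r s : on (Own (Row q n r) (3 + s)) (Column q n s)
| axis_on_antidiagonal q n d : on (Own (Axis q) (3 + n)) (Antidiagonal q n d)
| grid_on_antidiagonal q n r s :
    on (Own (Row q n r) (3 + s)) (Antidiagonal q n (r + s)).

Definition shade (q : gadget) (k : nat) : nat := (snd q + k) mod 3.

Definition palette (l : line) : list nat :=
  match l with
  | Axis q | Row q _ _ => [shade q 1; shade q 1; shade q 0]
  | Column q _ _ => [shade q 2; shade q 2; shade q 0]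
  | Antidiagonal q _ _ => [shade q 1; shade q 1; shade q 2]
  end.

Definition precolor (p : point) : option nat :=
  match p with
  | Root _ => None
  | Own l m => nth_error (palette l) m
  end.

Lemma precolor_lt_3 (p : point) (c : nat) : precolor p = Some c -> c < 3.
Proof.
  assert (H : forall q k, shade q k < 3)
    by (intros; apply Nat.mod_upper_bound; lia).
  destruct p as [i|[q|q n r|q n s|q n d] [|[|[|m]]]]; simpl; intros E;
    try discriminate; try (injection E as <-; apply H).
  all: destruct m; discriminate.
Qed.

Lemma precolored_on (p : point) (l : line) :
  on p l -> precolor p <> None -> In p [Own l 0; Own l 1; Own l 2].
Proof.
  intros Hon Hp; destruct Hon; simpl in Hp; try congruence.
  (* An index [3 + _] runs past the three entries of a palette. *)
  2-4: destruct s + destruct n; simpl in Hp; congruence.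
  destruct m as [|[|[|m]]]; simpl; auto.
  exfalso; apply Hp; destruct l; simpl; destruct m; reflexivity.
Qed.

(** Two lines with a common root share nothing else: a row and a column that cross belong to one
    gadget, whose roots [i] and [i + S j] differ. Without a common root, any two of [r], [s],
    [r + s] determine a grid point. *)
Lemma on_two_lines (p p' : point) (l l' : line) :
  l <> l' -> on p l -> on p l' -> on p' l -> on p' l' -> p = p'.
Proof.
  intros Hne H1 H2 H3 H4.
  destruct H1; inversion H2; subst; try congruence;
    inversion H3; subst; inversion H4; subst; try congruence; try lia;
    try (f_equal; f_equal; lia).
Qed.

(** * Coding points by natural numbers *)

Definition line_code (l : line) : nat :=
  let code k i j a n r :=
    to_nat (k, to_nat (to_nat (to_nat (i, j), a), to_nat (n, r))) in
  match l with
  | Axis (i, j, a) => code 0 i j a 0 0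
  | Row (i, j, a) n r => code 1 i j a n r
  | Column (i, j, a) n s => code 2 i j a n s
  | Antidiagonal (i, j, a) n d => code 3 i j a n d
  end.

Definition line_decode (x : nat) : line :=
  let (k, t) := of_nat x in
  let (u, v) := of_nat t in
  let (w, a) := of_nat u in
  let q := (of_nat w, a) in
  let (n, r) := of_nat v in
  match k with
  | 0 => Axis q
  | 1 => Row q n r
  | 2 => Column q n r
  | _ => Antidiagonal q n r
  end.

Definition point_code (p : point) : nat :=
  match p with
  | Root i => to_nat (0, i)
  | Own l m => to_nat (S (line_code l), m)
  end.

Definition point_decode (x : nat) : point :=
  match of_nat x with
  | (0, i) => Root i
  | (S k, m) => Own (line_decode k) m
  end.

Lemma line_codeK (l : line) : line_decode (line_code l) = l.
Proof.
  destruct l as [[[i j] a]|[[i j] a] n r|[[i j] a] n s|[[i j] a] n d];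
    unfold line_decode, line_code; now rewrite !cancel_of_to.
Qed.

Lemma point_codeK (p : point) : point_decode (point_code p) = p.
Proof.
  destruct p as [i|l m]; unfold point_decode, point_code;
    rewrite cancel_of_to; [|rewrite line_codeK]; reflexivity.
Qed.

Definition points_of (l : line) (x : nat) : Prop :=
  exists p, x = point_code p /\ on p l.

Lemma points_of_infinite (l : line) : infinite_set (points_of l).
Proof.
  intros n; exists (point_code (Own l n)); split.
  - simpl; pose proof (to_nat_non_decreasing (S (line_code l)) n); lia.
  - exists (Own l n); split; [reflexivity|constructor].
Qed.

Lemma card_le_1 (S : nat -> Prop) :
  (forall x y, S x -> S y -> x = y) -> card_le S 1.
Proof.
  intros H; destruct (classic (exists x, S x)) as [[x Hx]|Hno].
  - exists [x]; split; [simpl; lia|]. intros y Hy; left; auto.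
  - exists []; split; [simpl; lia|]. intros y Hy; exfalso; eauto.
Qed.

Lemma points_of_almost_disjoint :
  almost_disjoint 2 (fun A => exists l, A = points_of l).
Proof.
  intros A B [l ->] [l' ->] Hne; apply card_le_1.
  intros x y [[p [-> Hp]] [p1 [E1 Hp1]]] [[p' [-> Hp']] [p2 [E2 Hp2]]].
  apply (f_equal point_decode) in E1, E2; rewrite !point_codeK in E1, E2.
  subst p1 p2; f_equal.
  apply (on_two_lines p p' l l'); congruence.
Qed.

(** * Counting in the grid *)

Lemma grid_not_colorable (k : nat -> nat -> nat) (a b c : nat) :
  (forall r s, k r s = a \/ k r s = b \/ k r s = c) ->
  (forall r s s', k r s = c -> k r s' = c -> s = s') ->
  (forall r r' s, k r s = b -> k r' s = b -> r = r') ->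
  (forall r r' s s', r + s = r' + s' -> k r s = a -> k r' s' = a -> r = r') ->
  False.
Proof.
  intros Hcov Hrow Hcol Hdiag.
  (* The key names the line on which the cell's colour cannot recur: rows are 0 to 3, columns 4 to
     7, antidiagonals 8 to 14. So 16 cells would get distinct keys below 15. *)
  pose (key rs := let (r, s) := rs : nat * nat in
    if k r s =? c then r else if k r s =? b then 4 + s else 8 + (r + s)).
  pose (cells := list_prod (seq 0 4) (seq 0 4)).
  assert (Hcells : forall r s, In (r, s) cells -> r < 4 /\ s < 4).
  { intros r s H; apply in_prod_iff in H; rewrite !in_seq in H; lia. }
  assert (Hinj : NoDup (map key cells)).
  { apply NoDup_map_NoDup_ForallPairs.
    - intros [r s] [r' s'] [Hr Hs]%Hcells [Hr' Hs']%Hcells; unfold key.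
      destruct (Nat.eqb_spec (k r s) c) as [Hc|Hc], (Nat.eqb_spec (k r' s') c) as [Hc'|Hc'];
        destruct (Nat.eqb_spec (k r s) b) as [Hb|Hb], (Nat.eqb_spec (k r' s') b) as [Hb'|Hb'];
        cbv iota; intros E; try lia.
      1-2: rewrite <- E in *; f_equal; eauto.
      + assert (s' = s) as -> by lia. f_equal; eauto.
      + assert (r + s = r' + s') as Es by lia.
        assert (r = r') by (apply (Hdiag r r' s s' Es);
          [destruct (Hcov r s) as [|[|]] | destruct (Hcov r' s') as [|[|]]]; congruence).
        f_equal; lia.
    - repeat constructor; simpl; intuition congruence. }
  assert (Hincl : incl (map key cells) (seq 0 15)).
  { intros x [[r s] [<- [Hr Hs]%Hcells]]%in_map_iff; apply in_seq; unfold key.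
    destruct (k r s =? c), (k r s =? b); simpl; lia. }
  pose proof (NoDup_incl_length Hinj Hincl) as Hlen.
  vm_compute in Hlen; lia.
Qed.

(** * Colours forced by conflict freeness *)

Section Coloring.

Variable h : point -> nat.
Hypothesis h_lt_3 : forall p, h p < 3.
Hypothesis h_precolor : forall p c, precolor p = Some c -> h p = c.
Hypothesis h_conflict_free :
  forall l, exists c p, on p l /\ h p = c /\
    forall p', on p' l -> h p' = c -> p' = p.

(** The colour occurring once is not [y], taken by two precoloured points, nor [x], taken by [p] and
    [Own l 2]. *)
Lemma third_color_once (l : line) (x y z : nat) (p : point) :
  palette l = [y; y; x] -> (forall c, c < 3 -> c = x \/ c = y \/ c = z) ->
  on p l -> p <> Own l 2 -> h p = x ->
  exists p0, on p0 l /\ h p0 = z /\ forall p', on p' l -> h p' = z -> p' = p0.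
Proof.
  intros Hpal Hcov Hp Hne Hx.
  assert (H : forall m c, nth_error [y; y; x] m = Some c -> h (Own l m) = c).
  { intros m c E; apply h_precolor; simpl; now rewrite Hpal. }
  pose proof (H 0 y eq_refl) as H0.
  pose proof (H 1 y eq_refl) as H1.
  pose proof (H 2 x eq_refl) as H2.
  destruct (h_conflict_free l) as (c & p0 & Hp0 & Hc & Huniq).
  destruct (Hcov c) as [->|[->| ->]].
  - rewrite <- Hc; apply h_lt_3.
  - exfalso; apply Hne.
    rewrite (Huniq p Hp Hx); symmetry; apply Huniq; auto using on.
  - exfalso.
    pose proof (Huniq _ (on_own l 0) H0); pose proof (Huniq _ (on_own l 1) H1).
    congruence.
  - exists p0; auto.
Qed.

Lemma roots_differ (i j : nat) : h (Root i) <> h (Root (i + S j)).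
Proof.
  intros Heq.
  pose (q := (i, j, h (Root i)) : gadget).
  pose (a := shade q 0); pose (b := shade q 1); pose (c := shade q 2).
  assert (a = h (Root i) /\ a <> c /\ b <> c /\
    forall x, x < 3 -> x = a \/ x = b \/ x = c) as (Ha & Hac & Hbc & Hcov).
  { subst a b c; unfold shade, q; simpl snd.
    pose proof (h_lt_3 (Root i)).
    destruct (h (Root i)) as [|[|[|]]]; repeat split; simpl in *; intros; lia. }
  assert (Haxis : on (Root i) (Axis q)) by constructor.
  assert (Hrow : forall n r, on (Root i) (Row q n r)) by constructor.
  assert (Hcol : forall n s, on (Root (i + S j)) (Column q n s)) by constructor.
  destruct (third_color_once (Axis q) a b c (Root i)) as (z & Hz & Hzc & _);
    auto; try discriminate.
  (* The root and the precoloured axis points have colours [a] and [b] only. *)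
  assert (exists n, z = Own (Axis q) (3 + n)) as [n ->].
  { inversion Hz as [l m El| i' j' a' Ei| | | | |]; subst z.
    - pose proof (h_precolor (Own (Axis q) 0) b eq_refl).
      pose proof (h_precolor (Own (Axis q) 1) b eq_refl).
      pose proof (h_precolor (Own (Axis q) 2) a eq_refl).
      destruct m as [|[|[|n]]]; [exfalso; congruence..|now exists n].
    - exfalso; congruence. }
  apply (grid_not_colorable (fun r s => h (Own (Row q n r) (3 + s))) a b c).
  - intros; apply Hcov, h_lt_3.
  - intros r s s' E E'.
    destruct (third_color_once (Row q n r) a b c (Root i)) as (p & _ & _ & Hp);
      auto; try discriminate.
    pose proof (Hp _ (on_own _ _) E) as H1; pose proof (Hp _ (on_own _ _) E') as H2.
    simpl in H1, H2; congruence.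
  - intros r r' s E E'.
    destruct (third_color_once (Column q n s) a c b (Root (i + S j))) as (p & _ & _ & Hp);
      auto; try discriminate; try congruence.
    { intros x Hx; destruct (Hcov x Hx) as [|[|]]; auto. }
    pose proof (Hp _ (grid_on_column _ _ _ _) E).
    pose proof (Hp _ (grid_on_column _ _ _ _) E'). congruence.
  - intros r r' s s' Es E E'.
    (* The axis point of colour [c] now plays the part of the root. *)
    destruct (third_color_once (Antidiagonal q n (r + s)) c b a (Own (Axis q) (3 + n)))
      as (p & _ & _ & Hp);
      auto using axis_on_antidiagonal; try discriminate.
    { intros x Hx; destruct (Hcov x Hx) as [|[|]]; auto. }
    pose proof (Hp _ (grid_on_antidiagonal _ _ _ _) E) as H1.
    rewrite Es in Hp.
    pose proof (Hp _ (grid_on_antidiagonal _ _ _ _) E') as H2. congruence.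
Qed.

Lemma no_conflict_free_coloring : False.
Proof.
  pose proof (roots_differ 0 0); pose proof (roots_differ 0 1).
  pose proof (roots_differ 0 2); pose proof (roots_differ 1 0).
  pose proof (roots_differ 1 1); pose proof (roots_differ 2 0).
  pose proof (h_lt_3 (Root 0)); pose proof (h_lt_3 (Root 1)).
  pose proof (h_lt_3 (Root 2)); pose proof (h_lt_3 (Root 3)).
  simpl in *; lia.
Qed.

End Coloring.

Theorem theorem7p7 :
  exists (F : (nat -> Prop) -> Prop) (f : nat -> option nat),
    (forall A, F A -> infinite_set A) /\
    almost_disjoint 2 F /\
    partial_into 3 f /\
    (forall A, F A -> card_le (fun x => A x /\ f x <> None) 3) /\
    ~ (exists g : nat -> nat,
         (forall x, g x < 3) /\ extends g f /\ conflict_free 3 F g).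
Proof.
  (* Numbers that code no point may be precoloured too, but lie on no line. *)
  exists (fun A => exists l, A = points_of l), (fun x => precolor (point_decode x)).
  repeat apply conj.
  - intros A [l ->]; apply points_of_infinite.
  - exact points_of_almost_disjoint.
  - intros x c; apply precolor_lt_3.
  - intros A [l ->].
    exists (map point_code [Own l 0; Own l 1; Own l 2]); split; [simpl; lia|].
    intros x [[p [-> Hp]] Hd]; rewrite point_codeK in Hd.
    apply in_map, precolored_on; assumption.
  - intros (g & Hlt & Hext & Hcf).
    apply (no_conflict_free_coloring (fun p => g (point_code p))).
    + auto.
    + intros p c E; apply Hext; now rewrite point_codeK.
    + intros l; destruct (Hcf _ (ex_intro _ l eq_refl)) as (c & _ & x & [[p [-> Hp]] Hc] & Hu).
      exists c, p; repeat split; auto.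
      intros p' Hp' Hc'.
      rewrite <- (point_codeK p'), <- (point_codeK p); f_equal.
      apply Hu; split; [exists p'|]; auto.
Qed.
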